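(* There exist absolute constants $C,c\in(0,\infty)$ such that the following holds for all $\varepsilon\in(0,\frac12]$, $d\in\mathbb{N}$ and every $(\varepsilon,d)$-configuration $\mathcal{S}_0$ in $\mathbb{T}^\omega$. Put $A(\mathcal{S}_0):=\frac{\varepsilon d}{\log(\varepsilon^{-1})}$. (i) For every $\lambda\in(0,\infty)$ and every measurable function $f$ on $\mathbb{T}^\omega$, $$|\{x\in\mathbb{T}^\omega:\mathcal{M}_{\mathcal{S}_0}f(x)>\lambda\}|\le C\,(1+A(\mathcal{S}_0))\int_{\mathbb{T}^\omega}\frac{|f|}{\lambda}\log\Big(e+\frac{|f|}{\lambda}\Big)\,dx .$$ (ii) (Sharpness.) If $K\in(0,\infty)$ is such that $$|\{x\in\mathbb{T}^\omega:\mathcal{M}_{\mathcal{S}_0}f(x)>\lambda\}|\le K\int_{\mathbb{T}^\omega}\frac{|f|}{\lambda}\log\Big(e+\frac{|f|}{\lambda}\Big)\,dx$$ for all $\lambda\in(0,\infty)$ and all measurable $f$, then $K\ge c\,(1+A(\mathcal{S}_0))$.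
   Context: $\mathbb{N}=\{1,2,\dots\}$; $\log$ is the natural logarithm. $\mathbb{T}^\omega$ is the product of countably many copies of $\mathbb{T}=\mathbb{R}/\mathbb{Z}$ (identified with $[0,1)$), with normalized Haar measure $dx$; $|E|$ denotes the measure of $E$. Sets $V_m$ and subgroups $H_m$, $m\in\mathbb{N}$. To each $m$ assign a finite list of positive integers (exponents) $(a_1,\dots,a_N)$ as follows. If $m=1$ the list is $(1)$. If $m=n^2+j$ with $n\ge 1$ and $1\le j\le n$, then $N=n+1$, $a_1=\dots=a_n=n$, $a_{n+1}=j$. If $m=n^2+n+j$ with $n\ge1$ and $1\le j\le n+1$, then $N=n+1$, $a_i=n+1$ for $i\le j$ and $a_i=n$ for $j<i\le n+1$. Put $V_m=\prod_{i=1}^N(0,2^{-a_i})\times\mathbb{T}\times\mathbb{T}\times\cdots$ and $H_m=\prod_{i=1}^N\{0,2^{-a_i},\dots,(2^{a_i}-1)2^{-a_i}\}\times\{0\}\times\{0\}\times\cdots$. The first $N$ coordinates are called the nonfree coordinates of $V_m$. (For example $V_2=(0,\frac12)^2\times\mathbb{T}\times\cdots$, $V_3=(0,\frac14)\times(0,\frac12)\times\mathbb{T}\times\cdots$, $V_4=(0,\frac14)^2\times\mathbb{T}\times\cdots$, $V_5=(0,\frac14)^2\times(0,\frac12)\times\mathbb{T}\times\cdots$.) Let $\mathcal{R}_0=\{t+V_m: m\in\mathbb{N},\ t\in H_m\}$. $(\varepsilon,d)$-configuration. Let $\varepsilon\in(0,\frac12]$, $d\in\mathbb{N}$, and let $Q=t+V_m\in\mathcal{R}_0$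 ($t\in H_m$) with $m$ so large that $V_m$ has at least $d$ nonfree coordinates. For $k\in\{1,\dots,d\}$ let $Q_k=T_k+Q$, where $T_k\in\mathbb{T}^\omega$ has $k$-th coordinate $(1-\varepsilon)|\pi_k(Q)|$ and all other coordinates $0$; here $\pi_k$ is the projection onto the $k$-th coordinate and $|\pi_k(Q)|$ is the length of $\pi_k(Q)\subset\mathbb{T}$. Then $\{Q_1,\dots,Q_d\}$ is called an $(\varepsilon,d)$-configuration around $Q$; an $(\varepsilon,d)$-configuration is an $(\varepsilon,d)$-configuration around some such $Q$. (The set $Q$ itself is not a member of the configuration.) Maximal operator. For a collection $\mathcal{B}$ of measurable sets of positive measure, $\mathcal{M}_{\mathcal{B}}f(x)=\sup_{B\in\mathcal{B},\,x\in B}\frac1{|B|}\int_B|f|\,dx$, with $\mathcal{M}_{\mathcal{B}}f(x)=0$ if no $B\in\mathcal{B}$ contains $x$. *)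

(* Defs.v *)
From HB Require Import structures.
From mathcomp Require Import all_boot all_order all_algebra.
From mathcomp Require Import all_classical all_reals all_analysis.
From mathcomp Require Import zify ring lra.

Set Implicit Arguments.
Unset Strict Implicit.
Unset Printing Implicit Defensive.

Import Order.TTheory GRing.Theory Num.Theory.
Import numFieldNormedType.Exports.

Local Open Scope classical_set_scope.
Local Open Scope ring_scope.

(* The circle group R/Z, with carrier [0, 1) and addition modulo 1. *)
Definition circle (R : realType) := {x : R | 0 <= x < 1}.

Section circle.
Context {R : realType}.
Implicit Types (x y : R) (u v w : circle R).

HB.instance Definition _ := [Choice of circle R by <:].

Definition frac x : R := x - (Num.floor x)%:~R.

Lemma frac_itv x : 0 <= frac x < 1.
Proof.
by rewrite /frac subr_ge0 floor_le /= ltrBlDr addrC -intrD1 floorD1_gt.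
Qed.

Definition to_circle x : circle R := exist _ (frac x) (frac_itv x).

Lemma frac_id x : 0 <= x < 1 -> frac x = x.
Proof. by move=> x01; rewrite /frac (@floor_def _ _ 0) ?subr0. Qed.

Lemma fracDz x (n : int) : frac (x + n%:~R) = frac x.
Proof.
by rewrite /frac floorDrz ?intr_int// intrKfloor intrD opprD addrACA subrr addr0.
Qed.

Lemma fracDl x y : frac (frac x + y) = frac (x + y).
Proof. by rewrite {2}/frac addrAC -mulrNz fracDz. Qed.

Lemma fracDr x y : frac (x + frac y) = frac (x + y).
Proof. by rewrite addrC fracDl addrC. Qed.

Definition circle_add u v := to_circle (val u + val v).
Definition circle_opp u := to_circle (- val u).

Let addA : associative circle_add.
Proof. by move=> u v w; apply: val_inj; rewrite /= fracDl fracDr addrA. Qed.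

Let addC : commutative circle_add.
Proof. by move=> u v; apply: val_inj; rewrite /= addrC. Qed.

Let add0 : left_id (to_circle 0) circle_add.
Proof. by move=> u; apply: val_inj; rewrite /= fracDl add0r frac_id ?(valP u). Qed.

Let addN : left_inverse (to_circle 0) circle_opp circle_add.
Proof. by move=> u; apply: val_inj; rewrite /= fracDl addNr. Qed.

HB.instance Definition _ := GRing.isZmodule.Build (circle R) addA addC add0 addN.
HB.instance Definition _ := isPointed.Build (circle R) 0.

End circle.

(* The group T^omega; its coordinates are numbered from 0. *)
Definition torus (R : realType) := nat -> circle R.

HB.instance Definition _ (R : realType) := GRing.Zmodule.on (torus R).
HB.instance Definition _ (R : realType) := Pointed.on (torus R).

Section torus.
Context {R : realType}.

(* They generate the product of the Borel sigma-algebras, which is the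
   Borel sigma-algebra of T^omega. *)
Definition cylinders : set (set (torus R)) :=
  \bigcup_k preimage_set_system [set: torus R] (fun x => val (x k))
    (@measurable _ (measurableTypeR R)).

HB.instance Definition _ := @isMeasurable.Build (sigma_display cylinders) (torus R)
  <<s cylinders >> (@sigma_algebra0 _ setT cylinders) (@sigma_algebraC _ cylinders)
  (@sigma_algebra_bigcup _ setT cylinders).

End torus.

Definition translate (V : zmodType) (t : V) (A : set V) : set V := [set t + v | v in A].

(* The normalized Haar measure is the only mu with this property. *)
Definition is_haar (R : realType) (mu : probability (torus R) R) : Prop :=
  forall (t : torus R) (A : set (torus R)), measurable A ->
    mu (translate t A) = mu A.

(* The list (a_1, ..., a_N) attached to m >= 1, written with the n >= 0 and
   1 <= j <= 2n + 1 such that m = n^2 + j; its three cases are expo1, expo_wide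
   and expo_deep below. *)
Definition expo_base (m : nat) : nat := (\max_(n < m | n ^ 2 < m) n)%N.

Definition expo (m : nat) : seq nat :=
  let n := expo_base m in
  let j := (m - n ^ 2)%N in
  if (j <= n)%N then rcons (nseq n n) j
  else nseq (j - n) n.+1 ++ nseq (n.+1 - (j - n)) n.

Lemma expo_baseE (n j : nat) : (0 < j <= n.*2.+1)%N -> expo_base (n ^ 2 + j) = n.
Proof.
move=> /andP[j0 jn]; apply/eqP; rewrite eqn_leq; apply/andP; split.
  by apply/bigmax_leqP => -[k /= _] kn; rewrite -ltnS -ltn_sqr; nia.
have nm : (n < n ^ 2 + j)%N by nia.
by apply: (@leq_bigmax_cond _ _ _ (Ordinal nm)) => /=; lia.
Qed.

Lemma expo1 : expo 1 = [:: 1%N].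
Proof. by rewrite /expo (@expo_baseE 0 1). Qed.

Lemma expo_wide (n j : nat) : (1 <= n)%N -> (1 <= j <= n)%N ->
  expo (n ^ 2 + j) = rcons (nseq n n) j.
Proof.
by move=> n1 /andP[j1 jn]; rewrite /expo expo_baseE ?addKn ?jn//; lia.
Qed.

Lemma expo_deep (n j : nat) : (1 <= n)%N -> (1 <= j <= n.+1)%N ->
  expo (n ^ 2 + n + j) = nseq j n.+1 ++ nseq (n.+1 - j) n.
Proof.
move=> n1 /andP[j1 jn]; rewrite /expo -addnA expo_baseE; last by lia.
by rewrite addKn addKn ifF//; lia.
Qed.

Section configuration.
Context {R : realType}.

(* The nonfree coordinates of V_m are those numbered i < nonfree m. *)
Definition nonfree (m : nat) : nat := size (expo m).

Definition V (m : nat) : set (torus R) :=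
  [set x : torus R | forall i, (i < nonfree m)%N -> 0 < val (x i) < 2 ^- nth 0%N (expo m) i].

Definition H (m : nat) : set (torus R) :=
  [set t : torus R | forall i,
    if (i < nonfree m)%N
    then exists2 k : nat, (k < 2 ^ nth 0%N (expo m) i)%N
                        & val (t i) = k%:R * 2 ^- nth 0%N (expo m) i
    else t i = 0].

Definition circle_length (I : set (circle R)) : R :=
  fine (lebesgue_measure [set val u | u in I]).

Definition shift_vec (eps : R) (Q : set (torus R)) (k : nat) : torus R :=
  fun i => if i == k then to_circle ((1 - eps) * circle_length [set x k | x in Q]) else 0.

Definition configuration_around (eps : R) (d : nat) (Q : set (torus R)) :
    set (set (torus R)) :=
  [set translate (shift_vec eps Q k) Q | k in [set k | (k < d)%N]].

Definition is_configuration (eps : R) (d : nat) (S : set (set (torus R))) : Prop :=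
  exists m (t : torus R), [/\ (1 <= m)%N, H m t, (d <= nonfree m)%N
    & S = configuration_around eps d (translate t (V m))].

Definition configA (eps : R) (d : nat) : R := eps * d%:R / ln eps^-1.

End configuration.

Section maximal.
Context d (T : measurableType d) (R : realType).
Variable mu : {measure set T -> \bar R}.
Local Open Scope ereal_scope.

Definition average (f : T -> R) (B : set T) : \bar R :=
  (mu B)^-1 * \int[mu]_(x in B) `|f x|%:E.

Definition maximal_op (F : set (set T)) (f : T -> R) (x : T) : \bar R :=
  if `[< exists2 B, F B & B x >]
  then ereal_sup [set average f B | B in [set B | F B /\ B x]]
  else 0.

Definition weak_LlogL (F : set (set T)) (K : R) (l : R) (f : T -> R) : Prop :=
  mu [set x | l%:E < maximal_op F f x] <=
  K%:E * \int[mu]_x ((`|f x| / l) * ln (expR 1 + `|f x| / l))%:E.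

End maximal.

(* Main.v *)
(** Write P_1, ..., P_d for the members of the configuration around Q and q for their common
    measure.  Off Q the P_k are disjoint, and inside Q they are independent events of relative
    measure eps.

    Upper bound: if |f| has average > l on P_k, then half of the mass comes either from P_k \ Q,
    which is harmless by disjointness, or from Q `&` P_k.  For at most ln(1/eps)/eps indices of the
    second kind, let N count the sets P_k containing a point.  Young's inequality in the form
    g (N - 6 ln(1/eps)) <= g ln g + eps^6 exp N, where by independence exp N has average at most
    eps^-3 on Q, controls the part of g = |f|/l above 1/(4 eps); the part below contributes at
    most half of the mass.

    Sharpness: test with (2/eps) 1_Q, whose average is 2 on every P_k, and with 2 1_(P_1). *)
Require Import Defs.
From mathcomp Require Import all_boot all_order all_algebra.
From mathcomp Require Import all_classical all_reals all_analysis.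
From mathcomp Require Import measurable_realfun zify ring lra.

Import Order.TTheory GRing.Theory Num.Theory.
Local Open Scope classical_set_scope.
Local Open Scope ring_scope.

(** * Elementary inequalities for the exponential and the logarithm *)

Section real_inequalities.
Context {R : realType}.
Implicit Types a b x eps : R.

Lemma expR1_ge2 : 2 <= expR 1 :> R.
Proof. by have := expR_ge1Dx (1 : R); lra. Qed.

(** Invert and square exp (-1/2) >= 1/2, which is the tangent-line bound. *)
Lemma expR1_le4 : expR 1 <= 4 :> R.
Proof.
have h : 2^-1 <= expR (- 2^-1) :> R by have := expR_ge1Dx (- 2^-1 : R); lra.
have e1 : expR 1 = (expR (- 2^-1))^-1 ^+ 2 :> R.
  by rewrite -expRN opprK expr2 -expRD; congr expR; field.
have h0 := expR_gt0 (- 2^-1 : R).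
have h' : (expR (- 2^-1))^-1 <= 2 :> R by rewrite invf_ple ?posrE//; lra.
have h'' : 0 <= (expR (- 2^-1))^-1 :> R by rewrite invr_ge0 ltW.
by rewrite e1; nra.
Qed.

(** This is the tangent-line inequality 1 + u <= exp u at u = b - ln a, multiplied by a. *)
Lemma young_LlogL a b : 0 <= a -> a * b <= a * ln a + expR b.
Proof.
rewrite le_eqVlt => /predU1P[<-|a0]; first by rewrite !mul0r add0r expR_ge0.
have h := expR_ge1Dx (b - ln a).
have e : expR b = a * expR (b - ln a).
  by rewrite expRD expRN lnK ?posrE// mulrCA divff ?mulr1 ?gt_eqF.
by rewrite e; nra.
Qed.

Lemma ln_expR1D_ge1 x : 0 <= x -> 1 <= ln (expR 1 + x).
Proof.
move=> x0; rewrite -[leLHS](expRK (R := R)) ler_ln ?posrE ?expR_gt0//.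
  by rewrite lerDl.
by rewrite ltr_wpDr ?expR_gt0.
Qed.

Lemma half_le_lnV eps : 0 < eps <= 2^-1 -> 2^-1 <= ln eps^-1.
Proof.
move=> /andP[e0 e1]; rewrite lnV ?posrE//.
have := expR_ge1Dx (ln eps); rewrite lnK ?posrE//; lra.
Qed.

(** For x <= 1 / (4 eps) the first term suffices. For larger x, Young's inequality with b = n - 6 ln
    (1/eps) leaves the excess 6 x ln (1/eps), and 13 = 1 + 6 * 2 comes from the bound [Ll]. The
    sixth power is to be played against an exponential moment of order eps^-3. *)
Lemma weight_LlogL eps x (n : R) : 0 < eps <= 2^-1 -> 0 <= x -> 0 <= n ->
  x * n <= n / (4 * eps) + 13 * (x * ln (expR 1 + x)) + eps ^+ 6 * expR n.
Proof.
move=> /andP[e0 e1] x0 n0; have e2 := expR1_ge2.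
have l1 := @ln_expR1D_ge1 _ x0.
have t0 : 0 <= eps ^+ 6 * expR n by rewrite mulr_ge0 ?exprn_ge0 ?expR_ge0// ltW.
have [xs|xs] := leP x (4 * eps)^-1.
  have : x * n <= n / (4 * eps) by rewrite mulrC ler_wpM2l.
  have : 0 <= x * ln (expR 1 + x) by rewrite mulr_ge0// (le_trans ler01).
  by lra.
have xp : 0 < x by apply: lt_trans xs; rewrite invr_gt0; lra.
pose L := - ln eps.
have L0 : 0 <= L by rewrite oppr_ge0 ln_le0//; lra.
have lnx : ln x <= ln (expR 1 + x) by rewrite ler_ln ?posrE//; lra.
(* Here 1/eps < 4 x <= (e + x)^2. *)
have Ll : L <= 2 * ln (expR 1 + x).
  rewrite /L -lnV ?posrE//.
  rewrite [leRHS](_ : _ = ln ((expR 1 + x) ^+ 2)); last first.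
    by rewrite lnXn ?mulr_natl// ltr_wpDr ?expR_gt0.
  rewrite ler_ln ?posrE ?invr_gt0 ?exprn_gt0//; try lra.
  have -> : eps^-1 = 4 * (4 * eps)^-1 by field; rewrite gt_eqF.
  by rewrite expr2; nra.
have y := young_LlogL x (n - 6 * L) x0.
have -> : eps ^+ 6 * expR n = expR (n - 6 * L).
  by rewrite -[in LHS](lnK e0) -expRM_natl -expRD; congr expR; rewrite /L mulrN opprK addrC.
have : x * L <= x * (2 * ln (expR 1 + x)) by rewrite ler_wpM2l.
have : x * ln x <= x * ln (expR 1 + x) by rewrite ler_wpM2l.
have : 0 <= n / (4 * eps) by rewrite divr_ge0//; lra.
by lra.
Qed.

Lemma configA_ge0 eps (D : nat) : 0 < eps <= 2^-1 -> 0 <= configA eps D.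
Proof.
move=> eps12; have := half_le_lnV _ eps12; have /andP[e0 _] := eps12 => L2.
by rewrite /configA divr_ge0 ?mulr_ge0 ?(ltW e0)//; lra.
Qed.

(* Discarding all but at most ln(1/eps)/eps indices loses only the factor 1 + 2 A. *)
Lemma exists_truncated_count eps (n0 D : nat) : 0 < eps <= 2^-1 ->
  (0 < n0 <= D)%N -> exists n : nat, [/\ (0 < n <= n0)%N, n%:R * eps <= ln eps^-1
    & n0%:R <= n%:R * (1 + 2 * configA eps D)].
Proof.
move=> eps12 /andP[n00 n0D]; have /andP[e0 e1] := eps12.
have L2 := half_le_lnV _ eps12; set L := ln eps^-1 in L2 *.
have A0 := configA_ge0 _ D eps12.
have [n0L|n0L] := leP (n0%:R * eps) L.
  exists n0; split=> //; first by rewrite n00 leqnn.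
  by rewrite ler_peMr//; lra.
have Le1 : 1 <= L / eps by rewrite ler_pdivlMr//; lra.
have /truncn_itv/andP[nl nu] : 0 <= L / eps by lra.
(* Since L >= 1/2 >= eps, the integer part n of L / eps is at least 1, so L / eps < n + 1 <= 2 n;
   hence n0 <= D <= 2 n D eps / L = 2 n A. *)
exists (Num.truncn (L / eps)); set n := Num.truncn _ in nl nu *.
have n1 : (0 < n)%N by rewrite lt0n; apply: contraTneq nu => ->; rewrite -leNgt.
have n1R : 1 <= n%:R :> R by rewrite ler1n.
split.
- rewrite n1 -(ler_nat R) (le_trans nl)// ler_pdivrMr//; exact: ltW.
- by rewrite -ler_pdivlMr.
have -> : configA eps D = D%:R * (eps / L) by rewrite /configA -/L; ring.
have n0D' : n0%:R <= D%:R :> R by rewrite ler_nat.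
have n2 : L / eps <= 2 * n%:R by move: nu; rewrite -natr1; lra.
have c0 : 0 <= eps / L by rewrite divr_ge0; lra.
have : 1 <= 2 * n%:R * (eps / L).
  have := ler_wpM2r c0 n2.
  suff -> : L / eps * (eps / L) = 1 by [].
  by field; rewrite !gt_eqF//; lra.
have D0 : 0 <= D%:R :> R by [].
by move=> /(ler_wpM2l D0); lra.
Qed.

End real_inequalities.

(** * Weak-type bounds for sets that overlap only inside [Q], where they are independent *)

Section overlapping_sets.
Context d (T : measurableType d) (R : realType) (mu : {measure set T -> \bar R}).
Implicit Types (A B : set T) (g : T -> R) (s : seq nat).

Lemma integral_setI_indicE A B g :
  (\int[mu]_(x in A `&` B) (g x)%:E = \int[mu]_(x in A) (g x * \1_B x)%:E)%E.
Proof.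
rewrite integral_mkcondr; apply: eq_integral => x _.
by rewrite patchE indicE; case: ifP => _; rewrite ?mulr1 ?mulr0.
Qed.

Lemma sum_integral_disjoint_le (E : nat -> set T) g s :
  (forall k, measurable (E k)) -> uniq s ->
  (forall j k x, j \in s -> k \in s -> E j x -> E k x -> j = k) ->
  measurable_fun setT g -> (forall x, 0 <= g x) ->
  (\sum_(k <- s) \int[mu]_(x in E k) (g x)%:E <=
   \int[mu]_(x in \big[setU/set0]_(k <- s) E k) (g x)%:E)%E.
Proof.
move=> mE us dE mg g0; rewrite ge0_integral_bigsetU//.
- by move=> j k /= js ks [x [/(dE _ _ _ js ks) /[apply]]].
- by apply/measurable_EFinP; exact: measurable_funTS.
- by move=> x _; rewrite lee_fin.
Qed.

Context (Q : set T) (P : nat -> set T) (D : nat) (q eps : R).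
Hypotheses (q0 : 0 < q) (eps12 : 0 < eps <= 2^-1).
Hypotheses (mQ : measurable Q) (mP : forall k, measurable (P k)).
Hypothesis muP : forall k, (k < D)%N -> mu (P k) = q%:E.

Let G s := foldr (fun k A => A `&` P k) Q s.

(** Mutual independence of the [P k] relative to [Q], each with conditional probability [eps]; the
    empty list also fixes the measure of [Q] as [q]. *)
Hypothesis muG : forall s, uniq s -> all (fun k => k < D)%N s ->
  mu (G s) = (eps ^+ size s * q)%:E.
Hypothesis PIQ : forall j k, (j < D)%N -> (k < D)%N -> j != k ->
  P j `&` P k `<=` Q.

Let mG s : measurable (G s).
Proof. by elim: s => //= k s ih; exact: measurableI. Qed.

Let muQ : mu Q = q%:E.
Proof. by have := @muG [::] isT isT; rewrite /= expr0 mul1r. Qed.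

Let muQP k : (k < D)%N -> mu (Q `&` P k) = (eps * q)%:E.
Proof. by move=> kD; have := @muG [:: k]; rewrite /= expr1 kD; exact. Qed.

Let N s x : R := \sum_(k <- s) \1_(P k) x.

Let mN s : measurable_fun setT (N s).
Proof. by apply: measurable_sum => k; exact: measurable_indic. Qed.

Let N_ge0 s x : 0 <= N s x.
Proof. by apply: sumr_ge0. Qed.

(** With [r] empty this is the moment generating function, at 1, of a sum of independent Bernoulli
    variables. The list [r] makes the induction go through: exp (1_P) = 1 + (e - 1) 1_P splits the
    integral in two, and the second half, restricted to [P k], moves [k] from [s] to [r]. *)
Lemma integral_expR_count s r : uniq (s ++ r) -> all (fun k => k < D)%N (s ++ r) ->
  (\int[mu]_(x in G r) (expR (N s x))%:E =
   (eps ^+ size r * q * (1 + (expR 1 - 1) * eps) ^+ size s)%:E)%E.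
Proof.
elim: s r => [|k s ih] r us sD.
  under eq_integral do rewrite /N big_nil expR0.
  by rewrite integral_cst// mul1e expr0 mulr1 muG.
have NE x : expR (N (k :: s) x) = expR (N s x) + (expR 1 - 1) * (expR (N s x) * \1_(P k) x).
  rewrite /N big_cons expRD indicE; case: (x \in P k).
    by rewrite mulr1 mulrBl mul1r addrC subrK.
  by rewrite expR0 mulr0 mulr0 addr0 mul1r.
have w0 : 0 <= expR 1 - 1 :> R by have := @expR1_ge2 R; lra.
have mexpN A : measurable_fun A (fun x => (expR (N s x))%:E).
  apply/measurable_EFinP; apply: measurable_funTS.
  exact: measurableT_comp.
have mexpNP A : measurable_fun A (fun x => (expR (N s x) * \1_(P k) x)%:E).
  apply/measurable_EFinP; apply: measurable_funTS.
  apply: measurable_funM; first exact: measurableT_comp.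
  exact: measurable_indic.
have expNP0 x : 0 <= expR (N s x) * \1_(P k) x by rewrite mulr_ge0 ?expR_ge0.
have usr : perm_eq (k :: s ++ r) (s ++ k :: r).
  by rewrite -(cat1s k r) -(cat1s k (s ++ r)) perm_catCA.
under eq_integral do rewrite NE EFinD EFinM.
rewrite ge0_integralD//; last by apply: emeasurable_funM => //; exact: measurable_cst.
rewrite ge0_integralZl_EFin//.
have /andP[_ us'] : (k \notin s ++ r) && uniq (s ++ r) by [].
have /andP[_ sD'] : (k < D)%N && all (fun k => k < D)%N (s ++ r) by [].
rewrite -integral_setI_indicE (_ : G r `&` P k = G (k :: r))// (ih r)// (ih (k :: r)).
- by rewrite -EFinM -EFinD /= !exprS; congr EFin; ring.
- by rewrite -(perm_uniq usr).
- by rewrite -(perm_all _ usr).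
Qed.

(** Summing the hypotheses on [g] bounds the integral of [g * N s] over [Q] below by n q / 2.
    Integrating [weight_LlogL] bounds it above by n q / 4 + n q / 8 plus 13 times the L log L
    integral, so n q / 8 remains on the left and 104 = 8 * 13. *)
Lemma independent_overlap_bound s g : (0 < size s)%N ->
  uniq s -> all (fun k => k < D)%N s ->
  (size s)%:R * eps <= ln eps^-1 -> measurable_fun setT g -> (forall x, 0 <= g x) ->
  (forall k, k \in s -> ((q / 2)%:E <= \int[mu]_(x in Q `&` P k) (g x)%:E)%E) ->
  (((size s)%:R * q)%:E <= 104%:E * \int[mu]_x (g x * ln (expR 1 + g x))%:E)%E.
Proof.
move=> s0 us sD sL mg g0 gP.
have /andP[e0 e1] := eps12.
have phi0 x : 0 <= g x * ln (expR 1 + g x).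
  by rewrite mulr_ge0// (le_trans ler01)// ln_expR1D_ge1.
have mphi A : measurable_fun A (fun x => g x * ln (expR 1 + g x)).
  apply: measurable_funTS; apply: measurable_funM => //.
  by apply: measurableT_comp => //; exact: measurable_funD.
have meN A : measurable_fun A (fun x => expR (N s x)).
  by apply: measurable_funTS; exact: measurableT_comp.
set n : R := (size s)%:R.
have n1 : 1 <= n by rewrite /n ler1n.
have intP : ((n * (q / 2))%:E <= \int[mu]_(x in Q) (g x * N s x)%:E)%E.
  under eq_integral do rewrite /N mulr_sumr -sumEFin.
  rewrite ge0_integral_sum//; last 2 first.
  - move=> k; apply/measurable_EFinP; apply: measurable_funTS.
    by apply: measurable_funM => //; exact: measurable_indic.
  - by move=> k x _; rewrite lee_fin mulr_ge0.
  have -> : (n * (q / 2))%:E = (\sum_(k <- s) (q / 2)%:E)%E.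
    by rewrite sumEFin big_const_seq count_predT iter_addr addr0 mulr_natl.
  rewrite big_seq [leRHS]big_seq; apply: lee_sum => k ks.
  by rewrite -integral_setI_indicE gP.
have intN : (\int[mu]_(x in Q) (N s x)%:E = (n * (eps * q))%:E)%E.
  under eq_integral do rewrite /N -sumEFin.
  rewrite ge0_integral_sum//; last first.
    by move=> k; apply/measurable_EFinP; apply: measurable_funTS; exact: measurable_indic.
  have -> : (n * (eps * q))%:E = (\sum_(k <- s) (eps * q)%:E)%E.
    by rewrite sumEFin big_const_seq count_predT iter_addr addr0 mulr_natl.
  rewrite big_seq [RHS]big_seq; apply: eq_bigr => k ks.
  rewrite integral_indic// setIC muQP//.
  by move/allP : sD; apply.
(* As e - 1 <= 3, the moment is at most q (1 + 3 eps)^n <= q exp (3 n eps), and n eps <= ln (1/eps)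
   by the restriction on the size of [s]. *)
have intE : (\int[mu]_(x in Q) (expR (N s x))%:E <= (q * eps ^- 3)%:E)%E.
  have := @integral_expR_count s [::]; rewrite cats0 => /(_ us sD) /= ->.
  rewrite lee_fin expr0 mul1r ler_wpM2l ?(ltW q0)//.
  have w3 : (expR 1 - 1) * eps <= 3 * eps.
    by rewrite ler_wpM2r ?(ltW e0)//; have := @expR1_le4 R; lra.
  have w0 : 0 <= (expR 1 - 1) * eps.
    by rewrite mulr_ge0 ?(ltW e0)//; have := @expR1_ge2 R; lra.
  apply: (@le_trans _ _ (expR (3 * eps) ^+ size s)).
    have h1 : 0 <= 1 + (expR 1 - 1) * eps by lra.
    have h2 : 1 + (expR 1 - 1) * eps <= expR (3 * eps).
      by apply: le_trans (expR_ge1Dx _); lra.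
    by rewrite lerXn2r ?nnegrE ?expR_ge0.
  rewrite -expRM_natl -exprVn -(lnK (x := eps^-1)) ?posrE ?invr_gt0//.
  by rewrite -expRM_natl ler_expR; rewrite /n in sL; lra.
(* The term n q / 4 is the integral n eps q of the count divided by 4 eps; the last one comes from
   eps^6 * q eps^-3 = eps^3 q <= q / 8 and n >= 1. *)
have main : ((n * (q / 2))%:E <= (n * q / 4)%:E +
    13%:E * (\int[mu]_(x in Q) (g x * ln (expR 1 + g x))%:E) + (n * q / 8)%:E)%E.
  apply: (le_trans intP).
  apply: (@le_trans _ _ (\int[mu]_(x in Q) (((4 * eps)^-1)%:E * (N s x)%:E +
      13%:E * (g x * ln (expR 1 + g x))%:E + (eps ^+ 6)%:E * (expR (N s x))%:E)))%E.
    apply: ge0_le_integral => //.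
    - by move=> x _; rewrite lee_fin mulr_ge0.
    - by apply/measurable_EFinP; apply: measurable_funTS; exact: measurable_funM.
    - apply: emeasurable_funD; first apply: emeasurable_funD.
      + apply: emeasurable_funM; first exact: measurable_cst.
        by apply/measurable_EFinP; exact: measurable_funTS.
      + apply: emeasurable_funM; first exact: measurable_cst.
        exact/measurable_EFinP.
      + apply: emeasurable_funM; first exact: measurable_cst.
        exact/measurable_EFinP.
    - move=> x _; rewrite -!EFinM -!EFinD lee_fin.
      by rewrite [X in X + _ + _]mulrC; exact: weight_LlogL.
  have c0 : 0 <= (4 * eps)^-1 by rewrite invr_ge0; lra.
  have ee0 : 0 <= eps ^+ 6 by rewrite exprn_ge0// ltW.
  have m1 : measurable_fun Q (fun x => (N s x)%:E).
    by apply/measurable_EFinP; exact: measurable_funTS.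
  have m2 : measurable_fun Q (fun x => (g x * ln (expR 1 + g x))%:E).
    exact/measurable_EFinP.
  have m3 : measurable_fun Q (fun x => (expR (N s x))%:E).
    exact/measurable_EFinP.
  rewrite ge0_integralD//; first last.
  - by apply: emeasurable_funM => //; exact: measurable_cst.
  - by move=> x _; rewrite mule_ge0 ?lee_fin ?expR_ge0.
  - by apply: emeasurable_funD; apply: emeasurable_funM => //; exact: measurable_cst.
  - by move=> x _; rewrite adde_ge0 ?mule_ge0 ?lee_fin.
  rewrite ge0_integralD//; first last.
  - by apply: emeasurable_funM => //; exact: measurable_cst.
  - by move=> x _; rewrite mule_ge0 ?lee_fin.
  - by apply: emeasurable_funM => //; exact: measurable_cst.
  - by move=> x _; rewrite mule_ge0 ?lee_fin.
  rewrite !ge0_integralZl_EFin//; first last.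
  - by move=> x _; rewrite lee_fin.
  - by move=> x _; rewrite lee_fin.
  apply: leeD; first apply: leeD => //.
    by rewrite intN -EFinM lee_fin le_eqVlt; apply/orP; left; apply/eqP; field; rewrite gt_eqF.
  apply: (@le_trans _ _ ((eps ^+ 6)%:E * (q * eps ^- 3)%:E)%E).
    by rewrite lee_wpmul2l// lee_fin.
  rewrite -EFinM lee_fin.
  have -> : eps ^+ 6 * (q * eps ^- 3) = q * eps ^+ 3 by field; rewrite gt_eqF.
  have e3 : eps ^+ 3 <= 8^-1.
    have -> : 8^-1 = 2^-1 ^+ 3 :> R by field.
    by rewrite lerXn2r ?nnegrE ?invr_ge0// ltW.
  have := ler_wpM2l (ltW q0) e3; have : 1 * q <= n * q by rewrite ler_wpM2r// ltW.
  by lra.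
have mono : (\int[mu]_(x in Q) (g x * ln (expR 1 + g x))%:E <=
    \int[mu]_x (g x * ln (expR 1 + g x))%:E)%E.
  apply: ge0_subset_integral => //; first exact/measurable_EFinP.
  by move=> x _; rewrite lee_fin.
have : ((n * (q / 2))%:E <= (n * q / 4)%:E +
    13%:E * (\int[mu]_x (g x * ln (expR 1 + g x))%:E) + (n * q / 8)%:E)%E.
  by apply: (le_trans main); rewrite leeD2r// leeD2l// lee_wpmul2l// lee_fin.
have : (0 <= \int[mu]_x (g x * ln (expR 1 + g x))%:E)%E.
  by apply: integral_ge0 => x _; rewrite lee_fin.
case: (integral _ _ _) => [r| |]//.
  by rewrite -!EFinM -!EFinD !lee_fin; lra.
by move=> _ _; rewrite gt0_muley ?leey// lte_fin; lra.
Qed.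

Lemma measure_bigsetU_seq_le s : all (fun k => k < D)%N s ->
  (mu (\big[setU/set0]_(k <- s) P k) <= ((size s)%:R * q)%:E)%E.
Proof.
elim: s => [_|k s ih /= /andP[kD sD]]; first by rewrite big_nil measure0 mul0r.
rewrite big_cons.
apply: (@le_trans _ _ (mu (P k) + mu (\big[setU/set0]_(k <- s) P k))%E).
  by apply: measureU2 => //; exact: bigsetU_measurable.
by rewrite muP// -addn1 addnC natrD mulrDl mul1r EFinD; apply: leeD => //; exact: ih.
Qed.

(** The pieces [P k] minus [Q] are disjoint, and each has measure (1 - eps) q >= q / 2. *)
Lemma measure_bigsetU_seq_ge s : uniq s -> all (fun k => k < D)%N s ->
  (((size s)%:R * (q / 2))%:E <= mu (\big[setU/set0]_(k <- s) P k))%E.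
Proof.
move=> us /allP sD.
have mE k : measurable (P k `\` Q) by exact: measurableD.
have dE j k x : j \in s -> k \in s -> (P j `\` Q) x -> (P k `\` Q) x -> j = k.
  move=> /sD jD /sD kD [Pj nQ] [Pk _]; apply/eqP/negPn/negP => jk.
  by apply: nQ; exact: (PIQ _ _ jD kD jk).
have int1 A : measurable A -> (\int[mu]_(x in A) (cst 1 x : R)%:E = mu A)%E.
  by move=> mA; rewrite -[RHS]mul1e -integral_cst.
have := @sum_integral_disjoint_le _ (cst 1) s mE us dE (measurable_cst _) (fun=> ler01).
have mU : measurable (\big[setU/set0]_(k <- s) (P k `\` Q)) by exact: bigsetU_measurable.
have -> : (\sum_(k <- s) \int[mu]_(x in P k `\` Q) (cst 1 x : R)%:E =
           \sum_(k <- s) mu (P k `\` Q))%E.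
  by apply: eq_bigr => k _; exact: int1.
move=> h; have {}h := le_trans h (eq_ind_r (fun z => z <= _)%E (lexx _) (int1 _ mU)).
apply: (@le_trans _ _ (\sum_(k <- s) mu (P k `\` Q))%E); last first.
  apply: (le_trans h); apply: le_measure; rewrite ?inE; try exact: bigsetU_measurable.
  by rewrite -!bigcup_seq; apply: subset_bigcup => k _ x [].
have -> : ((size s)%:R * (q / 2))%:E = (\sum_(k <- s) (q / 2)%:E)%E.
  by rewrite sumEFin big_const_seq count_predT iter_addr addr0 mulr_natl.
rewrite big_seq [leRHS]big_seq; apply: lee_sum => k /sD kD.
have -> : (mu (P k `\` Q) = mu (P k) - mu (Q `&` P k))%E.
  rewrite setIC; apply: measureD => //.
  exact: (eq_ind_r (fun z => z < +oo)%E (ltry q) (muP k kD)).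
rewrite muP// muQP// -EFinB lee_fin.
by have /andP[_ e1] := eps12; have := ler_wpM2r (ltW q0) e1; lra.
Qed.

Let SP := [set P k | k in [set k | (k < D)%N]].

(** A supremum strictly above [l] has a member strictly above [l]. Positivity of [l] excludes the
    points lying in no [P k], where the operator takes the default value 0. *)
Lemma maximal_op_superlevel f (l : R) : 0 < l ->
  [set x | (l%:E < maximal_op mu SP f x)%E] =
  \big[setU/set0]_(k <- [seq k <- iota 0 D | `[< (l%:E < average mu f (P k))%E >]]) P k.
Proof.
move=> l0; rewrite -bigcup_seq; apply/seteqP; split => x /=; rewrite /maximal_op.
- case: asboolP => [_|_]; last by rewrite lte_fin ltNge ltW.
  move=> /ereal_sup_gt[_ [_ [[k kD <-] Pkx] <-] lk]; exists k => //=.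
  by rewrite mem_filter mem_iota add0n leq0n /= (kD : (k < D)%N) andbT; apply/asboolP.
- move=> [k /=]; rewrite mem_filter mem_iota add0n leq0n /= => /andP[/asboolP lk kD] Pkx.
  case: asboolP => [_|[]]; last by exists (P k) => //; exists k.
  by apply: (lt_le_trans lk); apply: ereal_sup_ubound; exists (P k) => //; split=> //; exists k.
Qed.

(** The indices whose average exceeds [l] are split by where the mass of g = |f| / l sits: outside
    [Q] disjointness applies, inside [Q] independence does. *)
Lemma weak_LlogL_overlapping f l : 0 < l -> measurable_fun setT f ->
  weak_LlogL mu SP (210 * (1 + configA eps D)) l f.
Proof.
move=> l0 mf; have /andP[e0 e1] := eps12.
rewrite /weak_LlogL maximal_op_superlevel//.
set J := [seq k <- _ | _].
have uJ : uniq J by rewrite filter_uniq// iota_uniq.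
have JD k : k \in J -> (k < D)%N.
  by rewrite mem_filter mem_iota add0n => /andP[_ /andP[]].
pose g x := `|f x| / l.
have g0 x : 0 <= g x by rewrite divr_ge0// ltW.
have mg : measurable_fun setT g.
  by apply: measurable_funM => //; exact: measurableT_comp.
have mgE A : measurable_fun A (fun x => (g x)%:E).
  by apply/measurable_EFinP; exact: measurable_funTS.
pose Phi := (\int[mu]_x (g x * ln (expR 1 + g x))%:E)%E.
rewrite -[X in (_ <= _ * X)%E]/Phi.
have phi0 x : 0 <= g x * ln (expR 1 + g x).
  by rewrite mulr_ge0// (le_trans ler01)// ln_expR1D_ge1.
have Phi0 : (0 <= Phi)%E by apply: integral_ge0 => x _; rewrite lee_fin.
have intg A : measurable A -> (\int[mu]_(x in A) (g x)%:E <= Phi)%E.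
  move=> mA; apply: (@le_trans _ _ (\int[mu]_x (g x)%:E)%E).
    by apply: ge0_subset_integral => // x _; rewrite lee_fin.
  apply: ge0_le_integral => //.
  - by move=> x _; rewrite lee_fin.
  - apply/measurable_EFinP; apply: measurable_funM => //.
    by apply: measurableT_comp => //; exact: measurable_funD.
  - by move=> x _; rewrite lee_fin ler_peMr// ln_expR1D_ge1.
(* An average of |f| above [l] on a set of measure [q], rescaled. *)
have intJ k : k \in J -> (q%:E < \int[mu]_(x in P k) (g x)%:E)%E.
  rewrite mem_filter mem_iota add0n leq0n => /andP[/asboolP].
  rewrite /average => + kD.
  rewrite muP// inver gt_eqF// lte_pdivlMl//.
  have -> : (\int[mu]_(x in P k) (g x)%:E =
      (l^-1)%:E * \int[mu]_(x in P k) `|f x|%:E)%E.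
    under eq_integral do rewrite /g mulrC EFinM.
    rewrite ge0_integralZl_EFin//.
    - apply/measurable_EFinP; apply: measurable_funTS; exact: measurableT_comp.
    - by rewrite invr_ge0 ltW.
  by rewrite lte_pdivlMl// -!EFinM mulrC.
pose big1 k := `[< ((q / 2)%:E <= \int[mu]_(x in P k `\` Q) (g x)%:E)%E >].
pose J1 := [seq k <- J | big1 k]; pose J2 := [seq k <- J | ~~ big1 k].
have sJ : size J = (size J1 + size J2)%N 
  by rewrite -(count_predC big1 J) /J1 /J2 !(size_filter _ J).
have J1P : (((size J1)%:R * (q / 2))%:E <= Phi)%E.
  have mE k : measurable (P k `\` Q) by exact: measurableD.
  have dE j k x : j \in J1 -> k \in J1 -> (P j `\` Q) x -> (P k `\` Q) x -> j = k.
    rewrite mem_filter => /andP[_ /JD jD]; rewrite mem_filter => /andP[_ /JD kD].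
    move=> [Pj nQ] [Pk _].
    by apply/eqP/negPn/negP => jk; apply: nQ; exact: (PIQ _ _ jD kD jk).
  have := @sum_integral_disjoint_le _ g J1 mE (filter_uniq _ uJ) dE mg g0.
  move=> h; have {}h := le_trans h (intg _ (bigsetU_measurable _ (fun k _ => mE k))).
  apply: le_trans h.
  have -> : ((size J1)%:R * (q / 2))%:E = (\sum_(k <- J1) (q / 2)%:E)%E.
    by rewrite sumEFin big_const_seq count_predT iter_addr addr0 mulr_natl.
  rewrite big_seq [leRHS]big_seq; apply: lee_sum => k.
  by rewrite mem_filter => /andP[/asboolP].
have J2P : (((size J2)%:R * q)%:E <= (104 * (1 + 2 * configA eps D))%:E * Phi)%E.
  have A0 := configA_ge0 _ D eps12.
  have [->|n0] := posnP (size J2).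
    by rewrite mul0r mule_ge0// lee_fin; lra.
  have uJ2 : uniq J2 by exact: filter_uniq.
  have J2D : all (fun k => k < D)%N J2.
    by apply/allP => k; rewrite mem_filter => /andP[_ /JD].
  have n0D : (0 < size J2 <= D)%N.
    rewrite n0 -[leqRHS](size_iota 0); apply: uniq_leq_size => // k.
    by rewrite mem_iota leq0n add0n; move/allP : J2D; apply.
  have [n [/andP[n1 nn0] nL n0n]] := exists_truncated_count _ _ _ eps12 n0D.
  have sn : size (take n J2) = n by rewrite size_takel.
  have inJ2 k : k \in take n J2 -> k \in J2 by exact: mem_take.
  have := @independent_overlap_bound (take n J2) g; rewrite sn.
  have u1 : uniq (take n J2) by exact: take_uniq.
  have u2 : all (fun k => k < D)%N (take n J2).
    by apply/allP => k /inJ2; move/allP : J2D; apply.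
  move=> /(_ n1 u1 u2 nL mg g0) bnd.
  (* For an index in [J2], the mass on [P k] exceeds [q] while the part off [Q] is below q / 2, so
     at least q / 2 lies in [Q]. Only the first [n] indices are used, as the exponential moment is
     controlled only up to that number. *)
  have {}bnd : ((n%:R * q)%:E <= 104%:E * Phi)%E.
    apply: bnd => k /inJ2; rewrite mem_filter => /andP[/= /asboolP nb /intJ].
    rewrite leNgt => qk; apply/negP => qQ.
    move: qk; rewrite -[X in integral _ X _](setUIDK _ Q) ge0_integral_setU//.
    - rewrite setIC; apply/negP; rewrite -leNgt ltW//.
      rewrite [in ltRHS](splitr q) EFinD; apply: lteD => //.
      by rewrite ltNge; apply/negP.
    - exact: measurableI.
    - exact: measurableD.
    - by move=> x _; rewrite lee_fin.
    - by apply/disj_setPS => x [[_ ?] [_]].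
  apply: (@le_trans _ _ ((1 + 2 * configA eps D)%:E * (n%:R * q)%:E)%E).
    rewrite -EFinM lee_fin mulrA ler_wpM2r ?(ltW q0)//.
    by rewrite mulrC.
  have B0 : 0 <= 1 + 2 * configA eps D by lra.
  rewrite [104 * _]mulrC (EFinM _ 104) -muleA.
  by rewrite lee_wpmul2l// lee_fin.
(* In units of [Phi], [J1] contributes 2 and [J2] contributes 104 (1 + 2 A); the sum 106 + 208 A is
   at most 210 (1 + A). *)
apply: (le_trans (measure_bigsetU_seq_le _ _)); first exact/allP.
have A0 := configA_ge0 _ D eps12.
rewrite sJ natrD; move: Phi0 J1P J2P; clear intg; case: Phi => [r| |]//.
- by rewrite -!EFinM !lee_fin => r0 h1 h2; have := mulr_ge0 A0 r0; lra.
- by move=> _ _ _; rewrite gt0_muley ?leey// lte_fin; lra.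
Qed.

(** Turns a test function h 1_B at level 1 into a lower bound for [K]: the average on each [P k]
    with [k] in [s] exceeds 1, so the superlevel set contains their union, while the L log L
    integral of an indicator is explicit. *)
Lemma weak_LlogL_indicator K (B : set T) (h : R) s :
  weak_LlogL mu SP K 1 (fun x => h * \1_B x) -> 0 < h -> measurable B ->
  uniq s -> all (fun k => k < D)%N s ->
  (forall k, k \in s -> (q%:E < h%:E * mu (B `&` P k))%E) ->
  (((size s)%:R * (q / 2))%:E <= (K * (h * ln (expR 1 + h)))%:E * mu B)%E.
Proof.
rewrite /weak_LlogL maximal_op_superlevel// => wk h0 mB us sD sB.
have fE x : `|h * \1_B x| / 1 = h * \1_B x.
  by rewrite divr1 ger0_norm// mulr_ge0// ltW.
set U := \big[setU/set0]_(k <- [seq k <- iota 0 D | _]) P k in wk.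
have sU : \big[setU/set0]_(k <- s) P k `<=` U.
  rewrite /U -!bigcup_seq => x [k /= ks Pkx]; exists k => //=.
  have kD : (k < D)%N by move/allP : sD; apply.
  rewrite mem_filter mem_iota leq0n add0n /= kD andbT; apply/asboolP.
  rewrite /average muP// inver gt_eqF// lte_pdivlMl// mule1.
  under eq_integral do rewrite -(divr1 `|_|) fE EFinM.
  rewrite ge0_integralZl_EFin ?(ltW h0)//; last first.
    by apply/measurable_EFinP; exact: measurable_indic.
  by rewrite integral_indic// sB.
apply: (le_trans (measure_bigsetU_seq_ge _ us sD)).
have muU : (mu (\big[setU/set0]_(k <- s) P k) <= mu U)%E.
  by apply: le_measure; rewrite ?inE//; exact: bigsetU_measurable.
apply: (le_trans muU); apply: (le_trans wk).
under eq_integral do rewrite fE.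
have -> : (\int[mu]_x (h * \1_B x * ln (expR 1 + h * \1_B x))%:E =
    (h * ln (expR 1 + h))%:E * mu B)%E.
  rewrite -[in RHS](setIT B) -(integral_indic _ measurableT)//.
  rewrite -ge0_integralZl_EFin//; last 2 first.
  - by apply/measurable_EFinP; exact: measurable_indic.
  - by rewrite mulr_ge0 ?(ltW h0)// (le_trans ler01)// ln_expR1D_ge1// ltW.
  apply: eq_integral => x _; rewrite -EFinM indicE; case: (x \in B).
    by rewrite !mulr1.
  by rewrite !mulr0 mul0r.
by rewrite muleA -EFinM.
Qed.

(** The two tests give 1 <= 8 K and A <= 12 K, so 1 + A <= 20 K, within the claimed 24 K. *)
Lemma weak_LlogL_overlapping_sharp K : (0 < D)%N -> 0 < K ->
  (forall (l : R) f, 0 < l -> measurable_fun setT f -> weak_LlogL mu SP K l f) ->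
  24^-1 * (1 + configA eps D) <= K.
Proof.
move=> D0 K0 wk; have /andP[e0 e1] := eps12.
have mind h B : measurable B -> measurable_fun setT (fun x : T => h * \1_B x : R).
  by move=> mB; apply: measurable_funM => //; exact: measurable_indic.
have E2 := @expR1_ge2 R; have E4 := @expR1_le4 R.
(* From ln (e + 2) <= 2 the test reads q / 2 <= 4 K q. *)
have K8 : 8^-1 <= K.
  have := @weak_LlogL_indicator K (P 0%N) 2 [:: 0%N] (wk _ _ ltr01 (mind _ _ (mP _))).
  have two0 : 0 < 2 :> R by [].
  rewrite /= D0 mul1r => /(_ two0 (mP _) isT isT) h.
  have {h} : ((q / 2)%:E <= (K * (2 * ln (expR 1 + 2)))%:E * mu (P 0%N))%E.
    apply: h => k; rewrite inE => /eqP ->.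
    by rewrite setIid muP// -EFinM lte_fin ltr_pMl// ltr1n.
  rewrite muP// -EFinM lee_fin.
  have l2 : ln (expR 1 + 2) <= 2 :> R.
    rewrite -[leRHS](expRK (R := R)) ler_ln ?posrE ?expR_gt0 ?addr_gt0 ?expR_gt0//.
    have -> : 2 = 1 + 1 :> R by lra.
    by rewrite expRD; nra.
  have : ln (expR 1 + 2) * (K * q) <= 2 * (K * q).
    by rewrite ler_wpM2r// mulr_ge0// ltW.
  move=> h1 h2; have h3 : 2^-1 * q <= 4 * K * q by lra.
  by move: h3; rewrite ler_pM2r//; lra.
have KA : configA eps D <= 12 * K.
  have := @weak_LlogL_indicator K Q (2 / eps) (iota 0 D) (wk _ _ ltr01 (mind _ _ mQ)).
  have iD k : k \in iota 0 D -> (k < D)%N by rewrite mem_iota.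
  have h0 : 0 < 2 / eps by rewrite divr_gt0.
  rewrite size_iota => /(_ h0 mQ (iota_uniq _ _)) h.
  have {h} : ((D%:R * (q / 2))%:E <= (K * (2 / eps * ln (expR 1 + 2 / eps)))%:E * mu Q)%E.
    apply: h => [|k /iD kD]; first exact/allP.
    rewrite muQP// -EFinM lte_fin.
    have -> : 2 / eps * (eps * q) = 2 * q by field; rewrite gt_eqF.
    by rewrite ltr_pMl// ltr1n.
  rewrite muQ -EFinM lee_fin.
  have L2 := half_le_lnV _ eps12; set L := ln eps^-1 in L2.
  (* With y = 1/eps >= 2, one has e + 2 y <= 4 y <= y^3. *)
  have ll : ln (expR 1 + 2 / eps) <= 3 * L.
    have y2 : 2 <= eps^-1 by rewrite -[leLHS]invrK lef_pV2 ?posrE// invr_gt0.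
    rewrite [leRHS](_ : _ = ln (eps^-1 ^+ 3)); last first.
      by rewrite lnXn ?mulr_natl// invr_gt0.
    rewrite ler_ln ?posrE ?exprn_gt0 ?invr_gt0//; last by lra.
    have : 4 * eps^-1 <= eps^-1 ^+ 3 by rewrite !exprS expr0; nra.
    by lra.
  have c0 : 0 <= K * (2 / eps) * q by rewrite mulr_ge0 ?(ltW q0)// mulr_ge0 ?(ltW K0) ?(ltW h0).
  have := ler_wpM2l c0 ll => h1 h2.
  have {h1 h2} h : D%:R / 2 * q <= (K * (2 / eps) * (3 * L)) * q by lra.
  move: h; rewrite ler_pM2r// => h.
  rewrite /configA ler_pdivrMr; last by rewrite -/L; lra.
  rewrite -/L; have := ler_wpM2l (ltW e0) h.
  have -> : eps * (K * (2 / eps) * (3 * L)) = 6 * K * L by field; rewrite gt_eqF.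
  by lra.
by lra.
Qed.

End overlapping_sets.

(* The defect phi r - r * phi 1 vanishes at 1, so it is additive on the circle R/Z, where
   its n-fold multiples stay bounded. *)
Lemma additive_itv01_linear (R : realType) (phi : R -> R) :
  (forall r s : R, 0 <= r -> 0 <= s -> r + s <= 1 -> phi (r + s) = phi r + phi s) ->
  (forall r : R, 0 <= r <= 1 -> 0 <= phi r) ->
  forall r : R, 0 <= r <= 1 -> phi r = r * phi 1.
Proof.
move=> phiD phi0 r /andP[r0]; rewrite le_eqVlt => /predU1P[->|r1]; first by rewrite mul1r.
pose D x := phi x - x * phi 1.
have DD (x y : R) : 0 <= x -> 0 <= y -> x + y <= 1 -> D (x + y) = D x + D y.
  by move=> x0 y0 xy; rewrite /D phiD//; ring.
have D1 : D 1 = 0 by rewrite /D mul1r subrr.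
have Dr (x : R) : 0 <= x <= 1 -> `|D x| <= phi 1.
  move=> /[dup] x01 /andP[x0 x1].
  have p1 : phi 1 = phi x + phi (1 - x) by rewrite -phiD ?subr_ge0// ?subrKC// addrC subrK.
  have p2 : 0 <= phi (1 - x) by apply: phi0; lra.
  have p3 := phi0 _ x01.
  have p4 : x * phi 1 <= phi 1 by rewrite ler_piMl//; lra.
  have p5 : 0 <= x * phi 1 by rewrite mulr_ge0//; lra.
  by rewrite ler_norml /D; apply/andP; split; lra.
(* If x + r >= 1, write x = (x + r - 1) + (1 - r); D (1 - r) = - D r because D 1 = 0. *)
have DfracD (x : R) : 0 <= x < 1 -> D (Defs.frac (x + r)) = D x + D r.
  move=> /andP[x0 x1]; have [xr|xr] := ltP (x + r) 1.
    by rewrite frac_id ?DD ?addr_ge0 ?(ltW xr).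
  have -> : x + r = (x + r - 1) + 1%:~R by rewrite subrK.
  rewrite fracDz frac_id; last by apply/andP; split; lra.
  have h1 : D x = D (x + r - 1) + D (1 - r) by rewrite -DD ?subr_ge0//; [congr D|..]; lra.
  have h2 : D 1 = D r + D (1 - r) by rewrite -DD ?subr_ge0//; [congr D|..]; lra.
  by lra.
have Dn n : D (Defs.frac (n%:R * r)) = n%:R * D r.
  elim: n => [|n ih].
    rewrite !mul0r frac_id; last by rewrite lexx ltr01.
    by have := DD 0 0 (lexx _) (lexx _); rewrite addr0 => /(_ ler01); lra.
  by rewrite -natr1 !mulrDl !mul1r -fracDl DfracD ?frac_itv// ih.
apply/eqP; rewrite -subr_eq0 -/(D r); apply/negPn/negP => Dr0.
have n0 : 0 < `|D r| by rewrite normr_gt0.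
pose n := (Num.truncn (phi 1 / `|D r|)).+1.
have : phi 1 < n%:R * `|D r|.
  by rewrite -ltr_pdivrMr//; apply: Num.Theory.truncnS_gt.
rewrite -[X in X * _]ger0_norm// -normrM -Dn ltNge Dr//.
by have /andP[-> /ltW ->] := frac_itv (n%:R * r).
Qed.

(** * Subtraction on the circle in terms of representatives *)

Section circle_arithmetic.
Context {R : realType}.
Implicit Types (u w : circle R).

Lemma val_circleB u w : val (u - w) = Defs.frac (val u - val w).
Proof. by rewrite /= fracDr. Qed.

Lemma val_to_circle (x : R) : 0 <= x < 1 -> val (to_circle x) = x.
Proof. exact: frac_id. Qed.

Lemma val_circleBE u w :
  val (u - w) = if val u < val w then val u - val w + 1 else val u - val w.
Proof.
rewrite val_circleB; have /andP[u0 u1] := valP u; have /andP[w0 w1] := valP w.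
case: (ltP (val u)) => uw; last by rewrite frac_id//; apply/andP; split; lra.
rewrite -(fracDz _ 1) frac_id//; apply/andP; split; lra.
Qed.

(** When [val u < s] the difference wraps around to val u - s + 1, which is at least l because s + l
    <= 1. *)
Lemma circleB_itv u (s l : R) : 0 <= s -> 0 < l -> s + l <= 1 ->
  (0 < val (u - to_circle s) < l) = (s < val u < s + l).
Proof.
move=> s0 l0 sl; have /andP[u0 u1] := valP u.
rewrite val_circleBE val_to_circle; last by apply/andP; split; lra.
by case: (ltP (val u) s) => us; apply/andP/andP => -[h1 h2]; split; lra.
Qed.

End circle_arithmetic.

(** * Haar measure of boxes in the infinite torus *)

Section torus_measure.
Context {R : realType}.
Implicit Types (t x : torus R) (A F : set (torus R)).

Lemma torusBE x t i : (x - t) i = x i - t i.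
Proof. by []. Qed.

Lemma translateE t A : translate t A = [set x | A (x - t)].
Proof.
apply/seteqP; split => x /=; first by move=> [v Av <-]; rewrite addrC addKr.
by move=> Ax; exists (x - t) => //; rewrite addrC subrK.
Qed.

Lemma measurable_coord i : measurable_fun setT (fun x : torus R => val (x i)).
Proof.
move=> _ B mB; apply: sub_sigma_algebra; exists i => //; exists B => //.
Qed.

(** It suffices to pull back the generating cylinders, and in one coordinate subtracting [t] is a
    piecewise translation with a single cut at [val (t i)]. *)
Lemma measurable_translate t A : measurable A -> measurable (translate t A).
Proof.
move=> mA; rewrite translateE -[X in measurable X]setTI.
suff : measurable_fun setT (fun x : torus R => x - t) by apply.
apply: (@measurability _ _ _ _ setT _ cylinders) => //.
move=> _ [_ [i _ [B mB <-]] <-]; rewrite setTI.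
have mBi : measurable_fun setT (fun x : torus R => val (x i - t i)).
  have -> : (fun x : torus R => val (x i - t i)) =
      (fun x => if val (x i) < val (t i) then val (x i) - val (t i) + 1
                else val (x i) - val (t i)).
    by apply/funext => x; rewrite val_circleBE.
  have mB1 : measurable_fun setT (fun x : torus R => val (x i) - val (t i)).
    by apply: measurable_funB => //; exact: measurable_coord.
  apply: measurable_fun_ifT => //; last exact: measurable_funD.
  by apply: measurable_fun_ltr => //; exact: measurable_coord.
exact: mBi.
Qed.

Context (mu : probability (torus R) R).
Hypothesis mu_haar : is_haar mu.

Let e i (r : R) : torus R := fun j => if j == i then to_circle r else 0.

Let mcoord i (B : set R) : measurable B ->
  measurable [set x : torus R | B (val (x i))].
Proof. by move=> mB; rewrite -[X in measurable X]setTI; exact: measurable_coord. Qed.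

Section slab.
Context (i : nat) (F : set (torus R)).
Hypotheses (mF : measurable F) (Fe : forall r, translate (e i r) F = F).

Let slab (B : set R) := F `&` [set x | B (val (x i))].

Let mslab B : measurable B -> measurable (slab B).
Proof. by move=> mB; apply: measurableI => //; exact: mcoord. Qed.

Lemma measure_slab_co (a b : R) : 0 <= a -> a <= b -> b <= 1 ->
  mu (slab `[a, b[) = mu (slab `[0, b - a[).
Proof.
move=> a0; rewrite le_eqVlt => /predU1P[->|ab] b1.
  by rewrite subrr !set_itvco0.
rewrite -(@mu_haar (e i a) (slab `[0, b - a[)); last exact: mslab.
have itvE (u v y : R) : `[u, v[%classic y = (u <= y < v) :> Prop by rewrite /= in_itv.
congr (mu _).
have FE x : F (x - e i a) = F x by rewrite -[in RHS](Fe a) translateE.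
have xE x : val ((x - e i a) i) = if val (x i) < a then val (x i) - a + 1 else val (x i) - a.
  rewrite torusBE /e eqxx val_circleBE val_to_circle//.
  by apply/andP; split; lra.
rewrite translateE; apply/seteqP; split => x [Fx xab]; split.
- by rewrite /= FE.
- move: xab; rewrite [_ x]itvE => /andP[h1 h2]; rewrite [_ (x - _)]itvE xE.
  by case: (ltP (val (x i)) a) => h; apply/andP; split; lra.
- by rewrite -FE.
- move: xab; rewrite [X in X -> _]itvE [X in _ -> X]itvE xE; have /andP[x0 x1] := valP (x i).
  by case: (ltP (val (x i)) a) => h /andP[h1 h2]; apply/andP; split; lra.
Qed.

(** The measure of the slab over [0, r) is additive in r by translation invariance along coordinate
    [i], hence linear. Half-open intervals are used because they tile exactly. *)
Lemma measure_slab (a b : R) : 0 <= a -> a <= b -> b <= 1 ->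
  mu (F `&` [set x | a < val (x i) < b]) = ((b - a)%:E * mu F)%E.
Proof.
have mub B : measurable B -> (mu (slab B) \is a fin_num).
  by move=> mB; rewrite fin_num_measure//; exact: mslab.
pose phi r := fine (mu (slab `[0, r[)).
have phiE r : mu (slab `[0, r[) = (phi r)%:E by rewrite fineK// mub.
have phiD r s : 0 <= r -> 0 <= s -> r + s <= 1 -> phi (r + s) = phi r + phi s.
  move=> r0 s0 rs; apply: EFin_inj; rewrite EFinD -!phiE.
  have -> : `[0, s[%classic = `[0, r + s - r[%classic by rewrite addrC addKr.
  rewrite -(measure_slab_co r (r + s))//; last by rewrite lerDl.
  rewrite -measureU//; try exact: mslab.
    rewrite /slab -setIUr; congr (mu (_ `&` _)); apply/seteqP; split => x /=.
      rewrite !in_itv/= => /andP[h1 h2]; case: (ltP (val (x i)) r) => h.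
        by left; rewrite h1.
      by right; rewrite h2.
    by rewrite !in_itv/= => -[] /andP[h1 h2]; apply/andP; split; lra.
  apply/seteqP; split => x // [[_ +] [_]] /=.
  by rewrite !in_itv/= => /andP[_ h1] /andP[h2 _]; have := lt_le_trans h1 h2; rewrite ltxx.
have phi1 : mu F = (phi 1)%:E.
  rewrite -phiE /slab; congr (mu _); apply/seteqP; split => [x Fx|x []//].
  by split => //=; rewrite in_itv/=; exact: (valP (x i)).
have phi0 r : 0 <= phi r by rewrite fine_ge0.
have lin := @additive_itv01_linear _ _ phiD (fun r _ => phi0 r).
have phi11 : phi 1 <= 1 by rewrite -lee_fin -phi1 probability_le1.
have co a' b' : 0 <= a' -> a' <= b' -> b' <= 1 ->
    mu (slab `[a', b'[) = ((b' - a') * phi 1)%:E.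
  by move=> h1 h2 h3; rewrite measure_slab_co// phiE lin//; apply/andP; split; lra.
move=> a0 ab b1.
have mo : measurable (slab `]a, b[) by exact: mslab.
have -> : F `&` [set x | a < val (x i) < b] = slab `]a, b[.
  by rewrite /slab; congr (_ `&` _); apply/seteqP; split => x /=; rewrite in_itv.
rewrite phi1 -EFinM -(fineK (mub _ (measurable_itv `]a, b[))); congr EFin.
set X := fine _; have XE : mu (slab `]a, b[) = X%:E by rewrite fineK// mub.
have X0 : 0 <= X by rewrite fine_ge0.
apply/le_anti/andP; split.
  rewrite -lee_fin -XE -co//; apply: le_measure; rewrite ?inE//; first exact: mslab.
  by apply: setIS => x /=; rewrite !in_itv/= => /andP[/ltW -> ->].
(* The open interval contains [a + z, b), which loses at most z since phi 1 <= 1; this avoids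
   computing the measure of the endpoint slice. *)
apply/ler_addgt0Pr => z z0.
have [zab|zab] := leP (b - a) z.
  have : (b - a) * phi 1 <= (b - a) * 1 by rewrite ler_wpM2l// subr_ge0.
  by lra.
have : (mu (slab `[(a + z)%R, b[) <= mu (slab `]a, b[))%E.
  apply: le_measure; rewrite ?inE//; first exact: mslab.
  by apply: setIS => x /=; rewrite !in_itv/= => /andP[h1 ->]; rewrite andbT; lra.
rewrite XE co; [|lra|lra|lra]; rewrite lee_fin => h.
have : z * phi 1 <= z * 1 by rewrite ler_wpM2l// ltW.
by lra.
Qed.

End slab.

Definition box (n : nat) (a b : nat -> R) : set (torus R) :=
  [set x : torus R | forall i, (i < n)%N -> a i < val (x i) < b i].

Lemma boxS n a b : box n.+1 a b = box n a b `&` [set x | a n < val (x n) < b n].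
Proof.
apply/seteqP; split => x /=.
  by move=> h; split=> [i ij|]; apply: h => //; exact: ltnW.
by move=> [h1 h2] i; rewrite ltnS leq_eqVlt => /predU1P[->//|]; exact: h1.
Qed.

Lemma measurable_box n a b : measurable (box n a b).
Proof.
elim: n => [|n ih].
  by rewrite (_ : box 0 a b = setT)//; apply/seteqP; split.
rewrite boxS; apply: measurableI => //.
have := mcoord n _ (measurable_itv `]a n, b n[).
by congr measurable; apply/seteqP; split => x /=; rewrite in_itv.
Qed.

(** A box in the coordinates below [n] is invariant under translations along coordinate [n], so each
    new side multiplies the measure by its length. *)
Lemma measure_box n a b : (forall i, (i < n)%N -> [/\ 0 <= a i, a i <= b i & b i <= 1]) ->
  mu (box n a b) = (\prod_(i < n) (b i - a i))%:E.
Proof.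
elim: n => [|n ih] h.
  rewrite big_ord0 (_ : box 0 a b = setT) ?probability_setT//.
  by apply/seteqP; split.
have [h1 h2 h3] := h n (ltnSn n).
rewrite boxS measure_slab//; last 2 first.
- exact: measurable_box.
- move=> r; rewrite translateE; apply/seteqP; split => x /= bx i ij; have := bx i ij;
  by rewrite torusBE /e ltn_eqF// subr0.
by rewrite ih => [|i ij]; [rewrite -EFinM big_ord_recr mulrC|apply: h; exact: ltnW].
Qed.

End torus_measure.

(** Thus all sides of [V m] have length at most 1/2, and a shift by less than one side does not wrap
    around the circle. *)
Lemma expo_gt0 m i : (0 < m)%N -> (i < nonfree m)%N -> (0 < nth 0%N (expo m) i)%N.
Proof.
move=> m0; rewrite /nonfree => im.
have : (expo_base m ^ 2 < m)%N.
  rewrite /expo_base; elim/big_ind: _ => [|x y xm ym|k km]; first by rewrite exp0n.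
    by case: (leqP x y) => _.
  by [].
have : nth 0%N (expo m) i \in expo m by exact: mem_nth.
move: (nth _ _ _) => a; rewrite /expo /=; set n := expo_base m; set j := (m - n ^ 2)%N.
case: (leqP j n) => jn.
  rewrite mem_rcons inE mem_nseq => /orP[/eqP ->|/andP[n0 /eqP ->]//].
  by rewrite /j subn_gt0.
rewrite mem_cat !mem_nseq => /orP[/andP[_ /eqP ->]//|/andP[h /eqP ->]].
(* For n = 0 the tail of entries equal to n is empty, because j >= 1. *)
by move=> nm; rewrite lt0n; apply: contraTneq h => n0; rewrite n0 in jn *; lia.
Qed.

(** * Configurations as translated boxes *)

Section configuration.
Context {R : realType}.
Context (eps : R) (m : nat) (t : torus R).
Hypotheses (eps12 : 0 < eps <= 2^-1) (m0 : (0 < m)%N) (Ht : H m t).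

Let N := nonfree m.
Let L (i : nat) : R := 2 ^- nth 0%N (expo m) i.
Let s (i : nat) : R := (1 - eps) * L i.
Let Q := translate t (V m).
Let P k := translate (shift_vec eps Q k) Q.

Let L_gt0 i : 0 < L i.
Proof. by rewrite invr_gt0 exprn_gt0. Qed.

Let L_le i : (i < N)%N -> L i <= 2^-1.
Proof.
move=> /(expo_gt0 m i m0); rewrite /L; case: nth => // a _.
by rewrite lef_pV2 ?posrE ?exprn_gt0// exprS ler_peMr// exprn_ege1// ler1n.
Qed.

Let s_bounds i : (i < N)%N -> [/\ 0 <= s i, s i <= L i & s i + L i <= 1].
Proof.
move=> iN; have := L_le i iN; have := L_gt0 i; have /andP[e0 e1] := eps12.
by rewrite /s => l0 l1; split; nra.
Qed.

Lemma translateVE : Q = translate t (box N (fun=> 0) L).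
Proof. by []. Qed.

(** As [t] lies in [H m], its coordinate is a multiple a L of the side with (a + 1) L <= 1, so the
    representatives of the projection form one interval in [0, 1]. *)
Lemma circle_length_coord k : (k < N)%N -> circle_length [set x k | x in Q] = L k.
Proof.
move=> kN; rewrite /circle_length.
have L0 := L_gt0 k.
have tL : 0 <= val (t k) /\ val (t k) + L k <= 1.
  have := Ht k; rewrite -/N kN => -[a ak ->]; split; first by rewrite mulr_ge0// ltW.
  rewrite -[X in _ + X]mul1r -/(L k) -mulrDl natr1 /L ler_pdivrMr ?exprn_gt0// mul1r.
  by rewrite -natrX ler_nat.
have [t0 t1] := tL.
have -> : [set val u | u in [set x k | x in Q]] = `]val (t k), val (t k) + L k[%classic.
  apply/seteqP; split => [y [_ [x [v Vv <-] <-] <-]|y].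
    have /andP[v0 v1] := Vv k kN; rewrite /= in_itv/= frac_id.
      by apply/andP; split; rewrite ?ltrDl// ltrD2l.
    apply/andP; split; first by rewrite addr_ge0// ltW.
    by rewrite (lt_le_trans _ t1)// ltrD2l.
  rewrite /= in_itv => /andP[y0 y1].
  have {}y0 : val (t k) < y by [].
  have {}y1 : y < val (t k) + L k by [].
  (* The midpoints in the other coordinates only serve to place [v] in [V m]. *)
  pose v : torus R := fun i => if i == k then to_circle (y - val (t k)) else to_circle (L i / 2).
  have Vv : V m v.
    move=> i iN; rewrite -/(L i) /v; have Li := L_gt0 i; have Li' := L_le i iN.
    case: eqP => [->|_].
      by rewrite val_to_circle; apply/andP; split; lra.
    by rewrite val_to_circle; apply/andP; split; lra.
  exists ((t + v) k); last first.
    rewrite /= /v eqxx /= fracDr addrC subrK frac_id//.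
    by apply/andP; split; lra.
  by exists (t + v) => //; exists v.
by rewrite lebesgue_measure_itv/= lte_fin ltrDl L0 -EFinB/= addrC addKr.
Qed.

Lemma translate_shiftE k : (k < N)%N ->
  P k = translate t (box N (fun i => if i == k then s i else 0)
                           (fun i => if i == k then s i + L i else L i)).
Proof.
move=> kN; rewrite /P [LHS]translateE [RHS]translateE; apply/seteqP.
have QE x : Q x <-> box N (fun=> 0) L (x - t) by rewrite /Q translateE.
have E x i : (i < N)%N -> (0 < val ((x - shift_vec eps Q k - t) i) < L i) =
    ((if i == k then s i else 0) < val ((x - t) i) < (if i == k then s i + L i else L i)).
  move=> iN; rewrite addrAC torusBE /shift_vec; case: eqP => [->|_]; last by rewrite subr0.
  rewrite circle_length_coord// -/(s k).
  by have [s0 _ sL] := s_bounds k kN; rewrite circleB_itv.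
split => x; first by move=> /QE h i iN; have := h i iN; rewrite E.
by move=> h; apply/QE => i iN; have := h i iN; rewrite -E.
Qed.

Let e (r : seq nat) i : R := if i \in r then s i else 0.

(** Intersecting with [P k] changes only side [k], where (0, L) meets (s, s + L) in (s, L). *)
Lemma foldr_setI_translate (r : seq nat) : {subset r <= gtn N} ->
  foldr (fun k A => A `&` P k) Q r = translate t (box N (e r) L).
Proof.
elim: r => [|k r ih] kr; first by rewrite translateVE.
have kN : (k < N)%N by apply: kr; rewrite inE eqxx.
have {}kr : {subset r <= gtn N} by move=> j jr; apply: kr; rewrite inE jr orbT.
rewrite /= ih// translate_shiftE// !translateE.
have e0 i : (i < N)%N -> 0 <= e r i.
  by move=> iN; rewrite /e; case: ifP => // _; have [] := s_bounds i iN.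
apply/seteqP; split => x /=.
- move=> [h1 h2] i iN; have := h1 i iN; have := h2 i iN.
  rewrite /e inE; case: eqP => //= _ /andP[-> _] /andP[_ ->//].
- move=> h; split=> i iN; have := h i iN; have [s0 sL _] := s_bounds i iN;
    rewrite /e inE; case: eqP => //= _ /andP[h1 h2].
  + by rewrite h2 andbT; case: ifP => _ //; exact: le_lt_trans h1.
  + by rewrite h1 (lt_le_trans h2)// lerDr.
  + by rewrite h2 andbT; apply: le_lt_trans h1; exact: e0.
Qed.

Context (mu : probability (torus R) R).
Hypothesis mu_haar : is_haar mu.

Let q : R := \prod_(i < N) L i.

(** Each index of [r] shortens its own side from L to L - s = eps L; distinct indices act on
    distinct coordinates, which is the source of independence. *)
Lemma measure_foldr_setI (r : seq nat) : uniq r -> {subset r <= gtn N} ->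
  mu (foldr (fun k A => A `&` P k) Q r) = (eps ^+ size r * q)%:E.
Proof.
move=> ur rN.
have prodE : \prod_(i < N) (L i - e r i) = eps ^+ size r * q.
  transitivity (\prod_(i < N) (if (i : nat) \in r then eps else 1) * q).
    rewrite /q -big_split; apply: eq_bigr => i _; rewrite /e /s; case: ifP => _ /=.
      by rewrite mulrBl mul1r subKr.
    by rewrite subr0 mul1r.
  congr (_ * _); rewrite -(big_mkord xpredT (fun i => if i \in r then eps else 1)).
  rewrite -big_mkcond -big_filter (perm_big r) /=.
    by rewrite big_const_seq count_predT iter_mulr_1.
  apply: uniq_perm => //; first by rewrite filter_uniq// iota_uniq.
  move=> i; rewrite mem_filter mem_index_iota; case ir: (i \in r) => //=.
  exact: rN.
rewrite foldr_setI_translate// mu_haar; last exact: measurable_box.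
rewrite (measure_box _ mu_haar) ?prodE//.
move=> i iN; have [s0 sL sL1] := s_bounds i iN; have := L_le i iN; rewrite /e.
by case: ifP => _; split=> //; rewrite ?ltW ?L_gt0//; lra.
Qed.

Lemma measure_translate_shift k : (k < N)%N -> mu (P k) = q%:E.
Proof.
move=> kN; rewrite translate_shiftE// mu_haar; last exact: measurable_box.
rewrite (measure_box _ mu_haar).
  by congr EFin; apply: eq_bigr => i _; case: ifP => _; rewrite ?subr0// addrC addKr.
move=> i iN; have [s0 sL sL1] := s_bounds i iN; have := L_le i iN; have := L_gt0 i.
by case: ifP => _; split=> //; lra.
Qed.

(** [P j] imposes the constraint of [Q] on every nonfree coordinate except [j], and [P k] supplies
    the one at [j]. *)
Lemma translate_shift_setI j k : (j < N)%N -> (k < N)%N -> j != k -> P j `&` P k `<=` Q.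
Proof.
move=> jN kN jk; rewrite !translate_shiftE// translateVE !translateE => x [hj hk] i iN.
have [ij|ij] := eqVneq i j.
  by have := hk i iN; rewrite ij (negbTE jk).
by have := hj i iN; rewrite (negbTE ij).
Qed.

End configuration.

Theorem theorem1p5 (R : realType) :
  exists C c : R, [/\ 0 < C, 0 < c &
    forall (mu : probability (torus R) R), is_haar mu ->
    forall (eps : R) (d : nat) (S0 : set (set (torus R))),
      0 < eps <= 2^-1 -> (1 <= d)%N -> is_configuration eps d S0 ->
      (forall (l : R) (f : torus R -> R), 0 < l -> measurable_fun setT f ->
         weak_LlogL mu S0 (C * (1 + configA eps d)) l f)
      /\
      (forall K : R, 0 < K ->
         (forall (l : R) (f : torus R -> R), 0 < l -> measurable_fun setT f ->
            weak_LlogL mu S0 K l f) ->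
         c * (1 + configA eps d) <= K)].
Proof.
exists 210, 24^-1; split=> //.
move=> mu mu_haar eps d S0 eps12 d0 [m [t [m0 Ht dN ->]]].
have dN' k : (k < d)%N -> (k < nonfree m)%N by move=> /leq_trans; apply.
pose Q := translate t (V m).
have mQ : measurable Q by apply: measurable_translate; exact: measurable_box.
pose P k := translate (shift_vec eps Q k) Q.
pose q : R := \prod_(i < nonfree m) 2 ^- nth 0%N (expo m) i.
have q0 : 0 < q by apply: prodr_gt0 => i _; rewrite invr_gt0 exprn_gt0.
have mP k : measurable (P k) by exact: measurable_translate.
have muP k (kd : (k < d)%N) : mu (P k) = q%:E.
  exact: (measure_translate_shift _ _ _ eps12 m0 Ht mu mu_haar _ (dN' k kd)).
have muG r : uniq r -> all (fun k => k < d)%N r ->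
    mu (foldr (fun k A => A `&` P k) Q r) = (eps ^+ size r * q)%:E.
  move=> ur /allP rd; apply: (measure_foldr_setI _ _ _ eps12 m0 Ht mu mu_haar r ur).
  by move=> k /rd /dN'.
have PIQ j k (jd : (j < d)%N) (kd : (k < d)%N) : j != k -> P j `&` P k `<=` Q.
  exact: (translate_shift_setI _ _ _ eps12 m0 Ht _ _ (dN' j jd) (dN' k kd)).
split=> [l f|K K0].
- exact: (weak_LlogL_overlapping _ _ _ mu Q P d q eps q0 eps12 mQ mP muP muG PIQ f l).
- exact: (weak_LlogL_overlapping_sharp _ _ _ mu Q P d q eps q0 eps12 mQ mP muP muG PIQ K d0 K0).
Qed.
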